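(* Let $f:\mathbb{R}^d\to\mathbb{R}$ be differentiable, $L$-smooth (i.e. $\|\nabla f(x)-\nabla f(y)\|\le L\|x-y\|$ for all $x,y\in\mathbb{R}^d$), and bounded from below by $f^*\in\mathbb{R}$. Suppose there exists $\mu>0$ such that $\|\nabla f(x)\|^2\ge2\mu(f(x)-f^* )$ for all $x\in\mathbb{R}^d$. Let $g$ be a gradient estimator for which there are constants $A,B,C,b\ge0$ such that for every $x\in\mathbb{R}^d$ $$\langle\nabla f(x),\mathbb{E}[g(x)]\rangle\ge b\|\nabla f(x)\|^2,\qquad \mathbb{E}[\|g(x)\|^2]\le 2A(f(x)-f^* )+B\|\nabla f(x)\|^2+C.$$ Let $\delta^0=f(x^0)-f^*$ and $\varepsilon>0$. Choose the stepsize $\gamma>0$ as $\gamma=\min\left\{\frac{\mu b}{L(A+\mu B)},\frac{1}{2\mu b},\frac{\varepsilon\mu b}{LC}\right\}$. Then, if $$T\ge\max\left\{2,\frac{L(A+\mu B)}{\mu^2b^2},\frac{LC}{\varepsilon\mu^2b^2}\right\}\log\frac{2\delta^0}{\varepsilon},$$ the iterates of BiasedSGD satisfy $\mathbb{E}[f(x^T)-f^*]\le\varepsilon$.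
   Context: A gradient estimator is a (possibly random, possibly biased) mapping $g:\mathbb{R}^d\to\mathbb{R}^d$. BiasedSGD with starting point $x^0\in\mathbb{R}^d$ and stepsize $\gamma>0$ is the iteration $x^{t+1}=x^t-\gamma g^t$, $t=0,1,2,\dots$, where $g^t=g(x^t)$ is a fresh realization of the estimator at $x^t$ (conditionally on $x^t$, $g^t$ has the law of $g(x)$ at $x=x^t$). $\mathbb{E}$ is expectation over the randomness of the algorithm, and $\|\cdot\|$ is the Euclidean norm. *)

(* Defs.v *)
(* R^d is 'rV[R]_d over an arbitrary R : realType. *)
From HB Require Import structures.
From mathcomp Require Import all_boot all_order all_algebra.
From mathcomp Require Import all_classical all_reals all_analysis.

Set Implicit Arguments.
Unset Strict Implicit.
Unset Printing Implicit Defensive.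

Import Order.TTheory GRing.Theory Num.Theory.
Import numFieldNormedType.Exports.

Local Open Scope classical_set_scope.
Local Open Scope ring_scope.

(* Matrices, hence row vectors, carry the Borel sigma-algebra of their topology. *)
HB.instance Definition _ (R : realType) (m n : nat) :=
  Measurable.copy 'M[R]_(m, n) (g_sigma_algebraType (@open 'M[R]_(m, n))).

Section Euclidean.
Context {R : realType} {d : nat}.
Implicit Types (u v x : 'rV[R]_d) (f : 'rV[R]_d -> R).

Definition dotp u v : R := \sum_(i < d) u 0 i * v 0 i.

(* The library norm `|u| on 'rV[R]_d is the sup norm, not the Euclidean one. It
   induces the same topology and the same notion of differentiability. *)
Definition enorm u : R := Num.sqrt (dotp u u).

Definition grad f x : 'rV[R]_d := \row_(i < d) 'D_(delta_mx 0 i) f x.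

Definition smooth (L : R) f : Prop :=
  forall x y, enorm (grad f x - grad f y) <= L * enorm (x - y).

End Euclidean.

Section Estimator.
Context {R : realType} {d : nat}.

(* A gradient estimator is a probability kernel G, where G x is the law of the
   random vector g(x). *)
Definition estimator : Type := R.-pker 'rV[R]_d ~> 'rV[R]_d.

Implicit Type G : estimator.

(* Rintegral returns 0 on non-integrable coordinates; this does not occur when the
   second moment below is finite. *)
Definition est_mean G (x : 'rV[R]_d) : 'rV[R]_d :=
  \row_(i < d) (\int[G x]_y (y 0 i))%R.

Definition est_second_moment G (x : 'rV[R]_d) : \bar R :=
  (\int[G x]_y ((enorm y) ^+ 2)%:E)%E.

Definition biased_abc (f : 'rV[R]_d -> R) (fstar A B C b : R) G : Prop :=
  forall x,
    b * enorm (grad f x) ^+ 2 <= dotp (grad f x) (est_mean G x) /\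
    (est_second_moment G x <=
      (2 * A * (f x - fstar) + B * enorm (grad f x) ^+ 2 + C)%:E)%E.

(* The last clause says that G (X t) is a regular conditional distribution of g t
   given X t. A realization that is moreover independent of the earlier iterates
   given X t is a special case. *)
Definition biased_sgd (dO : measure_display) (O : measurableType dO)
    (P : probability O R) G (gamma : R) (x0 : 'rV[R]_d)
    (X g : nat -> {RV P >-> 'rV[R]_d}) : Prop :=
  [/\ forall w, X 0 w = x0,
      forall t w, X t.+1 w = X t w - gamma *: g t w &
      forall t (U V : set 'rV[R]_d), measurable U -> measurable V ->
        P (X t @^-1` U `&` g t @^-1` V) =
          (\int[P]_(w in X t @^-1` U) G (X t w) V)%E].

End Estimator.

Arguments estimator : clear implicits.

(* Main.v *)
(* Write rho = gamma mu b and delta x = f x - fstar. Smoothness bounds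
   delta (x - gamma g) by a quadratic polynomial in g, which is nonnegative since it
   dominates delta; its mean under G x is at most
   (1 - rho) delta x + L gamma^2 C / 2 by the conditions on G, the PL inequality and
   the first bound on gamma. Integrating over the iterates,
   E delta (X t) <= (1 - rho)^t delta x0 + eps / 2, where the third bound on gamma
   gives the constant eps / 2; finally (1 - rho)^T <= exp (- rho T). *)

Require Import Defs.
From HB Require Import structures.
From mathcomp Require Import all_boot all_order all_algebra.
From mathcomp Require Import all_classical all_reals all_analysis.
From mathcomp Require Import measurable_realfun ring lra.

Set Implicit Arguments.
Unset Strict Implicit.
Unset Printing Implicit Defensive.

Import Order.TTheory GRing.Theory Num.Theory.
Import numFieldNormedType.Exports.

Local Open Scope classical_set_scope.
Local Open Scope ring_scope.

(** * Euclidean geometry of row vectors and the descent inequality for smooth functions *)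

Section EuclideanSpace.
Context {R : realType} {d : nat}.
Implicit Types (u v w x y : 'rV[R]_d) (f : 'rV[R]_d -> R).

Lemma dotpC u v : dotp u v = dotp v u.
Proof. by apply: eq_bigr => i _; rewrite mulrC. Qed.

Lemma dotpBl u v w : dotp (u - v) w = dotp u w - dotp v w.
Proof.
by rewrite /dotp -sumrB; apply: eq_bigr => i _; rewrite !mxE mulrBl.
Qed.

Lemma dotpBr u v w : dotp u (v - w) = dotp u v - dotp u w.
Proof. by rewrite dotpC dotpBl !(dotpC _ u). Qed.

Lemma dotpZr (a : R) u v : dotp u (a *: v) = a * dotp u v.
Proof. by rewrite mulr_sumr; apply: eq_bigr => i _; rewrite !mxE mulrCA. Qed.

Lemma dotpZl (a : R) u v : dotp (a *: u) v = a * dotp u v.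
Proof. by rewrite dotpC dotpZr dotpC. Qed.

Lemma dotp_ge0 u : 0 <= dotp u u.
Proof. by apply: sumr_ge0 => i _; rewrite -expr2 sqr_ge0. Qed.

Lemma enorm_ge0 u : 0 <= enorm u.
Proof. exact: sqrtr_ge0. Qed.

Lemma enorm_sqr u : enorm u ^+ 2 = dotp u u.
Proof. by rewrite sqr_sqrtr ?dotp_ge0. Qed.

Lemma enormZ (a : R) u : enorm (a *: u) = `|a| * enorm u.
Proof.
by rewrite /enorm dotpZl dotpZr mulrA -expr2 sqrtrM ?sqr_ge0 // sqrtr_sqr.
Qed.

Lemma normr_coord_le_enorm u i : `|u 0 i| <= enorm u.
Proof.
rewrite -sqrtr_sqr ler_sqrt ?dotp_ge0 // /dotp (bigD1 i) //= -expr2 lerDl.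
by apply: sumr_ge0 => j _; rewrite -expr2 sqr_ge0.
Qed.

(** Expanding the squared norm of [enorm v *: u - enorm u *: v] gives the claim multiplied by
    [enorm u * enorm v]. A vector of norm zero has zero coordinates, so the cases where this factor
    cannot be cancelled are trivial. *)
Lemma cauchy_schwarz u v : dotp u v <= enorm u * enorm v.
Proof.
have [v0|v_gt0] := leP (enorm v) 0.
  suff -> : dotp u v = 0 by rewrite mulr_ge0 ?enorm_ge0.
  apply: big1 => i _; apply/eqP; rewrite mulf_eq0 -[v 0 i == 0]normr_le0.
  by rewrite (le_trans (normr_coord_le_enorm v i)) ?orbT.
have [u0|u_gt0] := leP (enorm u) 0.
  suff -> : dotp u v = 0 by rewrite mulr_ge0 ?enorm_ge0.
  apply: big1 => i _; apply/eqP; rewrite mulf_eq0 -[u 0 i == 0]normr_le0.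
  by rewrite (le_trans (normr_coord_le_enorm u i)).
have := dotp_ge0 (enorm v *: u - enorm u *: v).
rewrite dotpBl !dotpBr !dotpZl !dotpZr -!enorm_sqr (dotpC v u) => sq_ge0.
have : 0 <= enorm u * enorm v * (enorm u * enorm v - dotp u v) by nra.
by rewrite pmulr_rge0 ?mulr_gt0 // subr_ge0.
Qed.

Lemma continuous_enorm : continuous (@enorm R d).
Proof.
have cdot : continuous (fun u => dotp u u).
  apply: (@continuous_big _ _ _ _ _ _ _ _ (fun i v => v 0 i * v 0 i)).
    exact: add_continuous.
  by move=> i _ u; apply: continuousM; exact: coord_continuous.
move=> u; apply: (@continuous_comp _ _ _ (fun v => dotp v v) Num.sqrt).
  exact: cdot.
exact: sqrt_continuous.
Qed.

Lemma derive_dotp_grad f x v : differentiable f x -> 'D_v f x = dotp (grad f x) v.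
Proof.
move=> df; rewrite deriveE // {1}[v]row_sum_delta linear_sum /=.
apply: eq_bigr => i _; rewrite linearZ /= mxE mulrC; congr (_ * _).
by rewrite deriveE.
Qed.

(** The difference quotient of the restriction to the line is literally the one defining the
    derivative of [f] at [x + t *: v] along [v]. *)
Lemma is_derive_line f x v (t : R) : differentiable f (x + t *: v) ->
  is_derive t 1 (fun s : R => f (x + s *: v)) (dotp (grad f (x + t *: v)) v).
Proof.
move=> df; rewrite -derive_dotp_grad //.
have E : (fun h : R => h^-1 *: (((fun s => f (x + s *: v)) \o shift t) (h *: 1)
           - f (x + t *: v))) =
         (fun h : R => h^-1 *: ((f \o shift (x + t *: v)) (h *: v)
           - f (x + t *: v))).
  apply/funext => h /=; congr (_ *: (f _ - _)).
  by rewrite scalerDl [h *: 1]mulr1 addrCA.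
split.
  by rewrite /derivable E; exact: diff_derivable df.
by rewrite /derive E.
Qed.

(** The mean value theorem on the segment replaces the usual integral remainder: the quadratic upper
    model is subtracted first, so that only the sign of a derivative matters. *)
Lemma smooth_descent (L : R) f x v :
  (forall y, differentiable f y) -> smooth L f ->
  f (x + v) <= f x + dotp (grad f x) v + L / 2 * enorm v ^+ 2.
Proof.
move=> df sf.
pose phi (t : R) := f (x + t *: v).
have dphi (t : R) : is_derive t 1 phi (dotp (grad f (x + t *: v)) v).
  exact: is_derive_line.
(* The claim is exactly [psi 1 <= psi 0]. *)
pose psi (t : R) := phi t - t * dotp (grad f x) v - t ^+ 2 * (L / 2 * enorm v ^+ 2).
have dpsi (t : R) : is_derive t 1 psi (dotp (grad f (x + t *: v)) v - dotp (grad f x) v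
    - L * t * enorm v ^+ 2).
  rewrite /psi; apply: is_derive_eq.
  set a := dotp (grad f _) v; rewrite /GRing.scale /=.
  by field.
have cpsi : {within `[0, 1], continuous psi}.
  apply: derivable_within_continuous => t _; exact: ex_derive.
have [c] := MVT ltr01 (fun t _ => dpsi t) cpsi.
rewrite in_itv /= => /andP[c0 c1]; rewrite subr0 mulr1 -dotpBl /psi /phi.
rewrite scale1r scale0r addr0 => E.
(* The derivative of [psi] at [c] is nonpositive: the gradient increment over [c *: v] has norm at
   most [L * c * enorm v], which the quadratic correction absorbs. *)
have := cauchy_schwarz (grad f (x + c *: v) - grad f x) v.
have := sf (x + c *: v) x.
rewrite [_ + _ - x]addrAC subrr add0r enormZ (gtr0_norm c0).
have := enorm_ge0 v.
move: E; set a := dotp _ v; set N := enorm v; set M := enorm (_ - _).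
move=> E N0 h1 h2.
have : M * N <= L * (c * N) * N by rewrite ler_wpM2r.
lra.
Qed.

End EuclideanSpace.

(** Open intervals generate the Borel sets of [R], and their preimages are open, hence among the
    generators on the row vectors. *)
Lemma continuous_measurable_rowfun (R : realType) d (f : 'rV[R]_d -> R) :
  continuous f -> measurable_fun [set: 'rV[R]_d] f.
Proof.
move=> /continuousP cf; apply: (measurability _ (RGenOpens.measurableE R)).
move=> _ [_ [a [b ->] <-]]; rewrite setTI.
by apply: sub_sigma_algebra; exact/cf/interval_open.
Qed.

(** * Integrating over a pair through the conditional law of its second component *)

Section Disintegration.
Context {R : realType} {dO dS dT : measure_display} {O : measurableType dO}
  {S : measurableType dS} {T : measurableType dT}.
Variables (P : probability O R) (X : O -> S) (g : O -> T) (G : R.-pker S ~> T).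
Hypotheses (mX : measurable_fun setT X) (mg : measurable_fun setT g).
Hypothesis XgG : forall U V, measurable U -> measurable V ->
  (P (X @^-1` U `&` g @^-1` V) = \int[P]_(w in X @^-1` U) G (X w) V)%E.

(* [graph_kernel x] is the law of (x, y) with y of law G x; averaging it over the law
   of X gives [joint_law], which agrees with the law of (X, g) on rectangles. *)
Let graph_kernel : R.-ker S ~> (S * T)%type :=
  mkcomp G (kdirac (@measurable_id _ (S * T)%type setT)).

(* The dummy argument turns P into a kernel, as required by [integral_kcomp]. *)
Let Xgraph_kernel (z : unit * O) : {measure set (S * T) -> \bar R} :=
  graph_kernel (X z.2).

Let measurable_Xgraph_kernel U : measurable U ->
  measurable_fun setT (Xgraph_kernel ^~ U : unit * O -> \bar R).
Proof.
move=> mU; apply: (measurableT_comp (measurable_kernel graph_kernel U mU)).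
exact: measurableT_comp.
Qed.

HB.instance Definition _ :=
  isKernel.Build _ _ _ _ _ Xgraph_kernel measurable_Xgraph_kernel.

Let Xgraph_kernel_setT z : Xgraph_kernel z setT = 1%E.
Proof.
rewrite /Xgraph_kernel /= /kcomp (eq_integral (cst 1%E)).
  by rewrite integral_cst // mul1e prob_kernel.
by move=> y _; rewrite /= /kdirac diracT.
Qed.

HB.instance Definition _ :=
  Kernel_isProbability.Build _ _ _ _ _ Xgraph_kernel Xgraph_kernel_setT.

Let const_kernel : unit -> {measure set O -> \bar R} := fun=> P.

HB.instance Definition _ := isKernel.Build _ _ _ _ _ const_kernel
  (fun U _ => measurable_cst (const_kernel tt U)).

HB.instance Definition _ := Kernel_isProbability.Build _ _ _ _ _ const_kernel
  (fun=> probability_setT P).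

Let joint_law : {measure set (S * T) -> \bar R} :=
  mkcomp const_kernel Xgraph_kernel tt.

Let integral_graph_kernel x (h : S * T -> \bar R) :
  (forall z, 0 <= h z)%E -> measurable_fun setT h ->
  (\int[graph_kernel x]_z h z = \int[G x]_y h (x, y))%E.
Proof.
move=> h0 mh; rewrite integral_kcomp //.
by apply: eq_integral => y _; rewrite integral_dirac // diracT mul1e.
Qed.

Let integral_joint_law (h : S * T -> \bar R) :
  (forall z, 0 <= h z)%E -> measurable_fun setT h ->
  (\int[joint_law]_z h z = \int[P]_w \int[G (X w)]_y h (X w, y))%E.
Proof.
move=> h0 mh; transitivity (\int[P]_w \int[graph_kernel (X w)]_z h z)%E.
  exact: (@integral_kcomp _ _ _ _ _ _ _ const_kernel Xgraph_kernel).
by apply: eq_integral => w _; rewrite integral_graph_kernel.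
Qed.

Let mXg : measurable_fun setT (fun w => (X w, g w)).
Proof. exact: measurable_fun_pair. Qed.

Let joint_lawE A : measurable A ->
  joint_law A = pushforward P (fun w => (X w, g w)) A.
Proof.
move=> mA.
(* Measurable rectangles are stable under intersection and generate the product sigma-algebra, so
   two finite measures agreeing on them are equal. *)
pose rect := [set U `*` V | U in measurable & V in measurable] : set (set (S * T)).
apply: (measure_unique rect (fun=> setT)) => //.
- exact: measurable_prod_measurableType.
- move=> _ _ [U1 mU1 [V1 mV1 <-]] [U2 mU2 [V2 mV2 <-]].
  exists (U1 `&` U2); first exact: measurableI.
  by exists (V1 `&` V2); [exact: measurableI|rewrite setXI].
- by move=> _; exists setT => //; exists setT => //; rewrite setXTT.
- by rewrite bigcup_const.
- move=> _ [U mU [V mV <-]].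
  rewrite /= [RHS](_ : _ = P (X @^-1` U `&` g @^-1` V)) // XgG //.
  rewrite [RHS]integral_mkcond; apply: eq_integral => w _.
  transitivity (\int[G (X w)]_y (\1_U (X w) * \1_V y)%:E)%E.
    by apply: eq_integral => y _; rewrite /= /kdirac diracE in_setX -mulnb natrM.
  rewrite patchE [w \in _](_ : _ = (X w \in U)) // indicE.
  case: (X w \in U).
    under eq_integral do rewrite mul1r.
    by rewrite integral_indic // setIT.
  by rewrite integral0_eq // => y _; rewrite mul0r.
(* The uniqueness theorem also asks for finite mass on the exhausting sets; the total mass here is
   1. *)
- move=> _; rewrite [ltLHS](_ : _ = \int[P]_w cst 1%E w)%E.
    by rewrite integral_cst // mul1e [X in (X < _)%E](probability_setT P) ltry.
  by apply: eq_integral => w _; exact: (Xgraph_kernel_setT (tt, w)).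
Qed.

(** The law of [(X, g)] is [joint_law], whose integrals are iterated by construction. *)
Lemma integral_disintegration (h : S * T -> \bar R) :
  (forall z, 0 <= h z)%E -> measurable_fun setT h ->
  (\int[P]_w h (X w, g w) = \int[P]_w \int[G (X w)]_y h (X w, y))%E.
Proof.
move=> h0 mh; rewrite -integral_joint_law //.
transitivity (\int[pushforward P (fun w => (X w, g w))]_z h z)%E.
  by rewrite ge0_integral_pushforward.
by apply: eq_measure_integral => A mA _; rewrite joint_lawE.
Qed.

End Disintegration.

(** * Moments of a probability law with finite second moment *)

Section EstimatorMoments.
Context {R : realType} {d : nat}.
Implicit Types (u y : 'rV[R]_d).

Lemma measurable_enorm_sqr : measurable_fun setT (fun y : 'rV[R]_d => enorm y ^+ 2).
Proof.
apply: continuous_measurable_rowfun => y.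
by apply: continuousM; exact: continuous_enorm.
Qed.

Lemma measurable_coord (i : 'I_d) : measurable_fun setT (fun y : 'rV[R]_d => y 0 i).
Proof. by apply: continuous_measurable_rowfun => y; exact: coord_continuous. Qed.

Section FiniteSecondMoment.
Variable Q : {measure set 'rV[R]_d -> \bar R}.
Hypothesis Q_setT : Q setT = 1%E.
Hypothesis Q_moment : (\int[Q]_y (enorm y ^+ 2)%:E < +oo)%E.

Lemma integrable_enorm_sqr : Q.-integrable setT (EFin \o (fun y => enorm y ^+ 2)).
Proof.
apply/integrableP; split; first by apply/measurable_EFinP; exact: measurable_enorm_sqr.
rewrite (eq_integral (fun y => (enorm y ^+ 2)%:E)) // => y _.
by rewrite /= ger0_norm ?sqr_ge0.
Qed.

Lemma integrable_unit_cst (a : R) : Q.-integrable setT (EFin \o cst a).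
Proof.
apply/integrableP; split; first by apply/measurable_EFinP; exact: measurable_cst.
rewrite (eq_integral (cst `|a|%:E)) // integral_cst //.
by rewrite Q_setT mule1 ltry.
Qed.

(** Each coordinate is dominated by [1 + enorm y ^+ 2], which follows from [(N - 1) ^+ 2 >= 0] with
    [N = enorm y]. *)
Lemma integrable_coord (i : 'I_d) : Q.-integrable setT (EFin \o (fun y => y 0 i)).
Proof.
have := integrableD measurableT (integrable_unit_cst 1) integrable_enorm_sqr.
apply: le_integrable => //; first by apply/measurable_EFinP; exact: measurable_coord.
move=> y _ /=; rewrite lee_fin [leRHS]ger0_norm ?addr_ge0 ?sqr_ge0 //.
have := normr_coord_le_enorm y i; have := enorm_ge0 y.
set N := enorm y; set c := `|_| => N0 cN.
by have := sqr_ge0 (N - 1); nra.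
Qed.

Lemma integrable_dotp u : Q.-integrable setT (EFin \o dotp u).
Proof.
rewrite (_ : _ \o _ = (fun y => \sum_(i < d) (u 0%R i)%:E * (y 0%R i)%:E)%E).
  apply: integrable_sum => // i _.
  exact: (integrableZl measurableT (u 0 i) (integrable_coord i)).
by apply/funext => y /=; rewrite sumEFin.
Qed.

Lemma Rintegral_dotp u :
  \int[Q]_y dotp u y = dotp u (\row_(i < d) \int[Q]_y y 0 i).
Proof.
pose h i (y : 'rV[R]_d) := ((u 0%R i)%:E * (y 0%R i)%:E)%E.
have h_int i : Q.-integrable setT (h i).
  by exact: (integrableZl measurableT (u 0 i) (integrable_coord i)).
rewrite /Rintegral (eq_integral (fun y => \sum_(i < d) h i y)%E); last first.
  by move=> y _; rewrite sumEFin.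
rewrite integral_sum // (eq_bigr (fun i => (u 0 i * \int[Q]_y y 0 i)%:E)).
  by rewrite sumEFin /=; apply: eq_bigr => i _; rewrite mxE.
move=> i _; rewrite -RintegralZl //; last exact: integrable_coord.
rewrite fineK //; exact: (integrable_fin_num measurableT (h_int i)).
Qed.

(** All three terms are integrable, so the extended integral is a real number and linearity applies.
    This is the shape of the smoothness bound as a polynomial in the stochastic gradient. *)
Lemma integral_quadratic (a c : R) u :
  (\int[Q]_y (a + dotp u y + c * enorm y ^+ 2)%:E =
   (a + dotp u (\row_(i < d) \int[Q]_y y 0 i)
      + c * \int[Q]_y (enorm y ^+ 2))%:E)%E.
Proof.
have i1 : Q.-integrable setT (EFin \o (fun y => a + dotp u y)).
  rewrite (_ : _ \o _ = (EFin \o cst a) \+ (EFin \o dotp u))%E //.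
  by apply: integrableD => //; [exact: integrable_unit_cst|exact: integrable_dotp].
have i2 : Q.-integrable setT (EFin \o (fun y => c * enorm y ^+ 2)).
  exact: (integrableZl measurableT c integrable_enorm_sqr).
under eq_integral do rewrite EFinD.
rewrite integralD_EFin // -[X in (X + _)%E]fineK; last exact: integrable_fin_num.
rewrite -[X in (_ + X)%E]fineK; last exact: integrable_fin_num.
rewrite -EFinD; congr (_%:E); congr (_ + _).
  rewrite -[LHS]/(Rintegral _ _ _) RintegralD //; last 2 first.
  - exact: integrable_unit_cst.
  - exact: integrable_dotp.
  by rewrite Rintegral_cst // Rintegral_dotp Q_setT mulr1.
by rewrite -[LHS]/(Rintegral _ _ _) RintegralZl //; exact: integrable_enorm_sqr.
Qed.

End FiniteSecondMoment.
End EstimatorMoments.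

(** * Real consequences of the stepsize formula in the extended reals *)

Section Stepsize.
Context {R : realType}.

Lemma le_ereal_div (gamma a m : R) : 0 <= a -> 0 <= m ->
  (gamma%:E <= a%:E / m%:E)%E -> gamma * m <= a.
Proof.
move=> a0; rewrite le_eqVlt => /predU1P[<- _|m0]; first by rewrite mulr0.
by rewrite inver gt_eqF // -EFinM lee_fin ler_pdivlMr.
Qed.

(** A zero denominator would make the quotient [+oo], which no real [gamma] equals; otherwise both
    divisions agree. *)
Lemma eq_ereal_div (gamma a m : R) : 0 < a ->
  gamma%:E = (a%:E / m%:E)%E -> gamma = a / m.
Proof.
move=> a0; rewrite inver; case: ifPn => [_|m0]; last by rewrite -EFinM => -[].
by rewrite gt0_muley ?lte_fin.
Qed.

Lemma stepsize_bounds (L A B C b mu eps gamma : R) :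
  0 <= L -> 0 <= A -> 0 <= B -> 0 <= C -> 0 <= b -> 0 < mu -> 0 < eps ->
  0 < gamma ->
  gamma%:E = (Order.min (Order.min ((mu * b)%:E / (L * (A + mu * B))%:E)
                          (1 / (2 * mu * b)%:E))
               ((eps * mu * b)%:E / (L * C)%:E))%E ->
  [/\ 0 < b, gamma * (L * (A + mu * B)) <= mu * b, gamma * (2 * mu * b) <= 1,
    gamma * (L * C) <= eps * mu * b &
    1 / (gamma * mu * b) <=
      Num.max (Num.max 2 (L * (A + mu * B) / (mu ^+ 2 * b ^+ 2)))
        (L * C / (eps * mu ^+ 2 * b ^+ 2))].
Proof.
move=> L0 A0 B0 C0 b0 mu0 eps0 g0 gE.
have mu_ge0 := ltW mu0; have eps_ge0 := ltW eps0.
have lt : (gamma%:E <= (mu * b)%:E / (L * (A + mu * B))%:E)%E.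
  by rewrite gE !ge_min lexx.
have := le_ereal_div (mulr_ge0 mu_ge0 b0)
  (mulr_ge0 L0 (addr_ge0 A0 (mulr_ge0 mu_ge0 B0))) lt => le1.
have le2 : gamma * (2 * mu * b) <= 1.
  apply: (le_ereal_div ler01); first by rewrite !mulr_ge0.
  by rewrite gE !ge_min lexx orbT.
have le3 : gamma * (L * C) <= eps * mu * b.
  apply: le_ereal_div; rewrite ?mulr_ge0 //.
  by rewrite gE !ge_min lexx orbT.
(* If [b = 0], the first term of the minimum is 0, even over a zero denominator since [0 * +oo = 0],
   contradicting [gamma > 0]. *)
have b_gt0 : 0 < b.
  rewrite lt_neqAle b0 andbT; apply/eqP => b_eq0.
  by move: lt; rewrite -b_eq0 mulr0 mul0e lee_fin leNgt g0.
split => //.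
have mub0 : 0 < mu * b by rewrite mulr_gt0.
(* Whichever term attains the minimum, [1 / (gamma * mu * b)] is exactly the corresponding term of
   the maximum. *)
move: gE; rewrite !minEle; case: ifP => _; [case: ifP => _|].
- set S := L * _ => /(eq_ereal_div mub0) gS.
  rewrite !le_max; apply/orP; left; apply/orP; right.
  (* In [R] the inverse of 0 is 0, so [S = 0] would force [gamma = 0]. *)
  have S0 : S != 0 by apply: contraTneq g0 => S0; rewrite gS S0 invr0 mulr0 ltxx.
  rewrite le_eqVlt gS; apply/orP; left; apply/eqP; field.
  by rewrite S0 !gt_eqF.
- move=> /(eq_ereal_div ltr01) ->; rewrite !le_max.
  apply/orP; left; apply/orP; left.
  rewrite le_eqVlt; apply/orP; left; apply/eqP; field.
  by rewrite !gt_eqF.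
- have epsmub0 : 0 < eps * mu * b by rewrite -mulrA mulr_gt0.
  set S := L * _ => /(eq_ereal_div epsmub0) gS.
  rewrite !le_max; apply/orP; right.
  have S0 : S != 0 by apply: contraTneq g0 => S0; rewrite gS S0 invr0 mulr0 ltxx.
  rewrite le_eqVlt gS; apply/orP; left; apply/eqP; field.
  by rewrite S0 !gt_eqF.
Qed.

End Stepsize.

(** A coordinate difference is at most [L * enorm (x - y)], which is continuous in [y] and vanishes
    at [x]. This yields measurability of the gradient. *)
Lemma continuous_grad_coord (R : realType) d (L : R) (f : 'rV[R]_d -> R) i :
  smooth L f -> continuous (fun x => grad f x 0 i).
Proof.
move=> sf x; apply/(cvgrPdist_lt (F := nbhs x)) => e e0.
have cv : L * enorm (x - y) @[y --> x] --> L * enorm (x - x).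
  apply: (cvgMr (F := nbhs x)).
  apply: (@continuous_comp _ _ _ (fun y => x - y) (@enorm R d)).
    by apply: (cvgB (F := nbhs x)); [exact: cvg_cst|exact: cvg_id].
  exact: continuous_enorm.
have : L * enorm (x - x) < e.
  by rewrite subrr -(scale0r x) enormZ normr0 mul0r mulr0.
move=> /(cvgr_lt (F := nbhs x) _ cv); apply: filterS => y; apply: le_lt_trans.
apply: le_trans (sf x y).
by have := normr_coord_le_enorm (grad f x - grad f y) i; rewrite !mxE.
Qed.

(** * One step of the iteration: pointwise, conditional and total expectation *)

Section Descent.
Context {R : realType} {d : nat}.
Variables (f : 'rV[R]_d -> R) (L fstar mu A B C b gamma : R) (G : estimator R d).
Hypotheses (f_diff : forall x : 'rV[R]_d, differentiable f x)
  (f_smooth : smooth L f) (f_ge : forall x, fstar <= f x)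
  (f_PL : forall x, 2 * mu * (f x - fstar) <= enorm (grad f x) ^+ 2)
  (G_abc : biased_abc f fstar A B C b G).
Hypotheses (L_ge0 : 0 <= L) (A_ge0 : 0 <= A) (C_ge0 : 0 <= C) (b_ge0 : 0 <= b)
  (mu_gt0 : 0 < mu) (gamma_ge0 : 0 <= gamma)
  (gamma_le : gamma * (L * (A + mu * B)) <= mu * b)
  (gamma_mub : gamma * mu * b <= 1).

(* Nonnegative by [sgd_majorantP] and [f_ge], so that its integrals need no
   integrability assumption on the iterates. *)
Definition sgd_majorant (z : 'rV[R]_d * 'rV[R]_d) : R :=
  f z.1 - fstar + dotp (- gamma *: grad f z.1) z.2
    + L * gamma ^+ 2 / 2 * enorm z.2 ^+ 2.

Lemma sgd_majorantP x y : f (x - gamma *: y) - fstar <= sgd_majorant (x, y).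
Proof.
have := smooth_descent x (- gamma *: y) f_diff f_smooth.
rewrite /sgd_majorant /= dotpZr dotpZl enormZ normrN (ger0_norm gamma_ge0).
rewrite scaleNr; lra.
Qed.

Lemma measurable_sgd_majorant : measurable_fun setT sgd_majorant.
Proof.
have mf : measurable_fun setT f.
  by apply: continuous_measurable_rowfun => x; exact: differentiable_continuous.
have mgrad i : measurable_fun setT (fun x => grad f x 0 i).
  apply: continuous_measurable_rowfun; exact: (continuous_grad_coord f_smooth).
apply: measurable_funD; first apply: measurable_funD.
- apply: measurable_funB => //.
  exact: (measurableT_comp mf measurable_fst).
- apply: measurable_sum => i; apply: measurable_funM; last first.
    exact: (measurableT_comp (measurable_coord i) measurable_snd).
  under eq_fun do rewrite mxE.
  apply: measurable_funM => //.
  exact: (measurableT_comp (mgrad i) measurable_fst).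
- apply: measurable_funM => //.
  exact: (measurableT_comp measurable_enorm_sqr measurable_snd).
Qed.

Lemma integral_sgd_majorant x :
  (\int[G x]_y (sgd_majorant (x, y))%:E <=
    ((1 - gamma * mu * b) * (f x - fstar) + L * gamma ^+ 2 / 2 * C)%:E)%E.
Proof.
have [bias second] := G_abc x.
have second_lty : (est_second_moment G x < +oo)%E.
  by rewrite (le_lt_trans second) ?ltry.
rewrite /sgd_majorant /= integral_quadratic ?prob_kernel // lee_fin.
rewrite -/(est_mean G x) dotpZl.
set m := \int[_]_y _; set D := dotp _ _ in bias *.
have : m <= 2 * A * (f x - fstar) + B * enorm (grad f x) ^+ 2 + C.
  rewrite -lee_fin fineK //.
  rewrite ge0_fin_numE //; apply: integral_ge0 => y _.
  by rewrite lee_fin sqr_ge0.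
have := f_PL x; have := f_ge x; rewrite -subr_ge0.
move: bias; set dl := f x - fstar; set N := enorm _ ^+ 2; set q := L * gamma ^+ 2 / 2.
move=> bias dl0 PL mle.
have q0 : 0 <= q by rewrite /q !mulr_ge0 ?sqr_ge0 ?invr_ge0.
have h1 := ler_wpM2l q0 mle.
have h2 := ler_wpM2l gamma_ge0 bias.
have N0 : 0 <= N by exact: sqr_ge0.
(* Dropping the [A] part of [gamma_le] and cancelling [mu] makes the net coefficient of [N]
   favourable, as needed to apply the PL inequality in [h3]. *)
have gLB : gamma * (L * B) <= b.
  rewrite -(ler_pM2l mu_gt0); apply: le_trans gamma_le.
  by have := mulr_ge0 gamma_ge0 (mulr_ge0 L_ge0 A_ge0); lra.
have qB : 0 <= gamma * b - q * B.
  have := ler_wpM2l gamma_ge0 gLB; have := mulr_ge0 gamma_ge0 b_ge0.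
  by rewrite /q; lra.
have h3 : 0 <= (gamma * b - q * B) * (N - 2 * mu * dl).
  by rewrite mulr_ge0 // subr_ge0.
(* After [h3] the gap contracts by [2 * gamma * mu * b]; the first stepsize bound shows that the
   second-moment term gives back at most half of this. *)
have h4 : 0 <= gamma * dl * (mu * b - gamma * (L * (A + mu * B))).
  by rewrite !mulr_ge0 ?subr_ge0.
move: h1 h2 h3 h4; rewrite /q => h1 h2 h3 h4.
lra.
Qed.

Lemma expected_descent (dO : measure_display) (O : measurableType dO)
    (P : probability O R) (x0 : 'rV[R]_d) (X g : nat -> {RV P >-> 'rV[R]_d}) t :
  biased_sgd G gamma x0 X g ->
  (\int[P]_w (f (X t.+1 w) - fstar)%:E <=
    (1 - gamma * mu * b)%:E * \int[P]_w (f (X t w) - fstar)%:E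
      + (L * gamma ^+ 2 / 2 * C)%:E)%E.
Proof.
case=> _ XS XgG.
have mdelta s : measurable_fun setT (fun w => (f (X s w) - fstar)%:E).
  apply/measurable_EFinP; apply: measurable_funB => //.
  apply: (measurableT_comp (f := f)) => //.
  by apply: continuous_measurable_rowfun => x; exact: differentiable_continuous.
have delta_ge0 s w : (0 <= (f (X s w) - fstar)%:E)%E by rewrite lee_fin subr_ge0.
have maj_ge0 z : (0 <= (sgd_majorant z)%:E)%E.
  case: z => x y; rewrite lee_fin.
  by apply: le_trans (sgd_majorantP x y); rewrite subr_ge0.
have mmaj : measurable_fun setT (EFin \o sgd_majorant).
  by apply/measurable_EFinP; exact: measurable_sgd_majorant.
have rho_ge0 : 0 <= 1 - gamma * mu * b by rewrite subr_ge0.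
apply: (@le_trans _ _ (\int[P]_w (EFin \o sgd_majorant) (X t w, g t w))%E).
  apply: ge0_le_integral => //.
    apply: (measurableT_comp mmaj).
    by apply: measurable_fun_pair; exact: measurable_funPT.
  by move=> w _; rewrite XS lee_fin sgd_majorantP.
(* Conditioning on the current iterate: [g t] is averaged under [G (X t w)], so the one-point bound
   applies inside the integral. *)
rewrite (integral_disintegration _ _ (XgG t)) //.
have c_ge0 : 0 <= L * gamma ^+ 2 / 2 * C.
  by rewrite !mulr_ge0 ?sqr_ge0 ?invr_ge0.
rewrite -ge0_integralZl_EFin //.
(* Since [P] has mass 1, the noise constant is its own integral, and both terms merge under one
   integral for a pointwise comparison. *)
rewrite -[X in (_ + X)%E](_ :
    \int[P]_w (cst (L * gamma ^+ 2 / 2 * C)%:E w) = _)%E; last first.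
  by rewrite integral_cst // [X in (_ * X)%E](probability_setT P) mule1.
have mrho : measurable_fun setT
    (fun w => (1 - gamma * mu * b)%:E * (f (X t w) - fstar)%:E)%E.
  exact: measurable_funeM.
rewrite -ge0_integralD //; last first.
  by move=> w _; rewrite mule_ge0 // lee_fin.
apply: ge0_le_integral => //.
- by move=> w _; apply: integral_ge0 => y _; exact: maj_ge0.
- have mint := @measurable_fun_integral_finite_kernel _ _ _ _ _ _ G maj_ge0 mmaj.
  by apply: (measurableT_comp mint).
- exact: emeasurable_funD.
- by move=> w _; rewrite -EFinM; exact: integral_sgd_majorant.
Qed.

End Descent.

(** * Unrolling the recursion and the exponential rate *)

Lemma expected_gap_bound (R : realType) (d : nat)
    (f : 'rV[R]_d -> R) (L fstar mu A B C b gamma eps : R) (G : estimator R d)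
    (dO : measure_display) (O : measurableType dO) (P : probability O R)
    (x0 : 'rV[R]_d) (X g : nat -> {RV P >-> 'rV[R]_d}) t :
  (forall x : 'rV[R]_d, differentiable f x) -> smooth L f ->
  (forall x, fstar <= f x) ->
  (forall x, 2 * mu * (f x - fstar) <= enorm (grad f x) ^+ 2) ->
  biased_abc f fstar A B C b G ->
  0 <= L -> 0 <= A -> 0 <= C -> 0 <= b -> 0 < mu -> 0 < eps -> 0 <= gamma ->
  gamma * (L * (A + mu * B)) <= mu * b -> gamma * mu * b <= 1 ->
  gamma * (L * C) <= eps * mu * b ->
  biased_sgd G gamma x0 X g ->
  (\int[P]_w (f (X t w) - fstar)%:E <=
    ((1 - gamma * mu * b) ^+ t * (f x0 - fstar) + eps / 2)%:E)%E.
Proof.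
move=> df sf f_ge PL abc L0 A0 C0 b0 mu0 eps_gt0 g0 gle gmub geps sgd.
(* With [rho = gamma * mu * b], this bounds the noise [L * gamma ^+ 2 / 2 * C] by [rho * eps / 2].
   As [(1 - rho) * eps / 2 + rho * eps / 2 = eps / 2], the additive constant survives the
   induction. *)
have geps2 := ler_wpM2l g0 geps.
elim: t => [|t IH].
  case: sgd => X0 _ _; rewrite expr0 mul1r.
  rewrite (eq_integral (cst (f x0 - fstar)%:E)); last by move=> w _; rewrite X0.
  rewrite integral_cst // [X in (_ * X)%E](probability_setT P) mule1 lee_fin.
  by rewrite lerDl divr_ge0 // ltW.
apply: le_trans.
  exact: (expected_descent df sf f_ge PL abc L0 A0 C0 b0 mu0 g0 gle gmub t sgd).
have rho0 : 0 <= 1 - gamma * mu * b by rewrite subr_ge0.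
apply: (@le_trans _ _ ((1 - gamma * mu * b)%:E *
    ((1 - gamma * mu * b) ^+ t * (f x0 - fstar) + eps / 2)%:E
  + (L * gamma ^+ 2 / 2 * C)%:E)%E).
  by rewrite leeD2r // lee_wpmul2l.
rewrite -EFinM -EFinD lee_fin [_ ^+ t.+1]exprS -[X in _ <= X + _]mulrA.
move: geps2; set Z := _ ^+ t * _; lra.
Qed.

(** From [1 - rho <= expR (- rho)], the contraction factor is at most [expR (- (rho * T%:R))], and
    the lower bound on [T] brings this below [eps / (2 * delta0)]. *)
Lemma contraction_le (R : realType) (rho delta0 eps M : R) (T : nat) :
  0 < rho -> rho <= 1 -> 0 <= delta0 -> 0 < eps -> rho^-1 <= M ->
  M * ln (2 * delta0 / eps) <= T%:R ->
  (1 - rho) ^+ T * delta0 <= eps / 2.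
Proof.
(* A zero initial gap is treated apart, since the logarithm inverts the exponential only at positive
   arguments. *)
move=> rho0 rho1 + eps0 rhoM MT; rewrite le_eqVlt => /predU1P[<-|d0].
  by rewrite mulr0 divr_ge0 // ltW.
have z0 : 0 < 2 * delta0 / eps by rewrite divr_gt0 // mulr_gt0.
have lnT : ln (2 * delta0 / eps) <= rho * T%:R.
  (* Replacing [M] by the smaller [rho^-1] preserves the bound only when the logarithm is
     nonnegative; a nonpositive one is below [rho * T%:R] anyway. *)
  have [ln0|ln0] := leP (ln (2 * delta0 / eps)) 0.
    by rewrite (le_trans ln0) // mulr_ge0 // ltW.
  rewrite -ler_pdivrMl //; apply: le_trans MT.
  by rewrite ler_wpM2r // ltW.
have expT : (1 - rho) ^+ T <= expR (- (rho * T%:R)).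
  rewrite -mulNr expRM_natr lerXn2r ?nnegrE ?subr_ge0 ?expR_ge0 //.
  exact: expR_ge1Dx.
apply: (@le_trans _ _ (expR (- ln (2 * delta0 / eps)) * delta0)).
  apply: ler_wpM2r; first exact: ltW.
  by apply: (le_trans expT); rewrite ler_expR lerN2.
rewrite expRN lnK //.
rewrite le_eqVlt; apply/orP; left; apply/eqP; field.
by rewrite !gt_eqF.
Qed.

(* The minimum defining gamma is taken in \bar R, where r / 0 = +oo for r > 0, so that a
   term with a zero denominator (for instance when C = 0) imposes no constraint. *)
Theorem corollary10 (R : realType) (d : nat)
  (f : 'rV[R]_d -> R) (L fstar mu : R)
  (f_diff : forall x : 'rV[R]_d, differentiable f x)
  (f_smooth : smooth L f)
  (f_ge : forall x, fstar <= f x)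
  (mu_gt0 : 0 < mu)
  (f_PL : forall x, 2 * mu * (f x - fstar) <= enorm (grad f x) ^+ 2)
  (G : estimator R d) (A B C b : R)
  (A_ge0 : 0 <= A) (B_ge0 : 0 <= B) (C_ge0 : 0 <= C) (b_ge0 : 0 <= b)
  (G_abc : biased_abc f fstar A B C b G)
  (x0 : 'rV[R]_d) (eps : R) (eps_gt0 : 0 < eps)
  (gamma : R) (gamma_gt0 : 0 < gamma)
  (gammaE : gamma%:E =
     (Order.min (Order.min ((mu * b)%:E / (L * (A + mu * B))%:E)
                          (1 / (2 * mu * b)%:E))
               ((eps * mu * b)%:E / (L * C)%:E))%E)
  (dO : measure_display) (O : measurableType dO) (P : probability O R)
  (X g : nat -> {RV P >-> 'rV[R]_d})
  (Xg_sgd : biased_sgd G gamma x0 X g)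
  (T : nat)
  (T_ge : Num.max (Num.max 2 (L * (A + mu * B) / (mu ^+ 2 * b ^+ 2)))
                  (L * C / (eps * mu ^+ 2 * b ^+ 2))
          * ln (2 * (f x0 - fstar) / eps) <= T%:R) :
  ('E_P[fun w => (f (X T w) - fstar)%R] <= eps%:E)%E.
Proof.
have [L_lt0|L_ge0] := ltP L 0.
  (* Only possible when d = 0. *)
  have enorm0 (u : 'rV[R]_d) : enorm u = 0.
    apply/eqP; rewrite eq_le enorm_ge0 andbT.
    have := le_trans (enorm_ge0 _) (f_smooth u 0).
    by rewrite subr0 nmulr_rge0.
  apply: (@le_trans _ _ (\int[P]_w cst 0%E w)%E); last first.
    by rewrite integral0 lee_fin ltW.
  rewrite unlock; under eq_integral => w _.
    (* With every Euclidean norm zero, the PL inequality forces [f] to equal [fstar] everywhere. *)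
    have -> : f (X T w) - fstar = 0.
      apply/eqP; rewrite eq_le subr_ge0 f_ge andbT.
      rewrite -(@pmulr_rle0 _ (2 * mu)) ?mulr_gt0 //.
      by rewrite (le_trans (f_PL _)) // enorm0 expr0n.
    over.
  by [].
have [b_gt0 gamma_le gamma_mub gamma_eps gamma_M] :=
  stepsize_bounds L_ge0 A_ge0 B_ge0 C_ge0 b_ge0 mu_gt0 eps_gt0 gamma_gt0 gammaE.
have rho_gt0 : 0 < gamma * mu * b by rewrite !mulr_gt0.
have rho_le1 : gamma * mu * b <= 1 by move: gamma_mub rho_gt0; lra.
rewrite unlock; apply: le_trans.
  exact: (expected_gap_bound T f_diff f_smooth f_ge f_PL G_abc L_ge0 A_ge0
    C_ge0 b_ge0 mu_gt0 eps_gt0 (ltW gamma_gt0) gamma_le rho_le1 gamma_eps Xg_sgd).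
rewrite lee_fin [leRHS](splitr eps) lerD2r.
apply: contraction_le T_ge => //; first by rewrite subr_ge0.
by rewrite -div1r.
Qed.
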